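(* Let $X$ be a non-empty set and let $\mathcal{F}$ be a $C^{\ast}$-subalgebra of $\ell^{\infty}(X)$ containing the constant functions. For $f\in\mathcal{F}$ let $\widehat{f}$ denote the unique function in $C(\delta X)$ with $f=\widehat{f}\circ e$. Then the mapping $\Gamma:\mathcal{F}\to C(\delta X)$ defined by $\Gamma(f)=\widehat{f}$ is an isometric $\ast$-isomorphism.
   Context: $\ell^{\infty}(X)$ is the $C^{\ast}$-algebra of all bounded complex-valued functions on $X$ (pointwise operations, supremum norm, involution given by complex conjugation). A filter on $X$ is a non-empty family of subsets of $X$ closed under finite intersections and under supersets and not containing $\emptyset$. An $\mathcal{F}$-family on $X$ is a non-empty set $\mathcal{A}$ of non-empty subsets of $X$ such that for every $A\in\mathcal{A}$ with $A\neq X$ there exist $B\in\mathcal{A}$ and $f\in\mathcal{F}$ with $f(B)=\{0\}$ and $f(X\setminus A)=\{1\}$. An $\mathcal{F}$-filter is a filter on $X$ which is also an $\mathcal{F}$-family; an $\mathcal{F}$-ultrafilter is an $\mathcal{F}$-filter not properly contained in any other $\mathcal{F}$-filter on $X$. $\delta X$ is the set of all $\mathcal{F}$-ultrafilters on $X$; for $A\subseteq X$ put $\widehat{A}=\{p\in\delta X: A\in p\}$, and give $\delta X$ the topology having $\{\widehat{A}:A\subseteq X\}$ as a base; $\delta X$ is a compact Hausdorff space. $\tau(\mathcal{F})$ is the weakest topology on $X$ making every $f\in\mathcal{F}$ continuous, and $\mathcal{N}_{\mathcal{F}}(x)$ is the neighborhood filter of $x$ in $(X,\tau(\mathcal{F}))$;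 it is an $\mathcal{F}$-ultrafilter. The evaluation mapping $e:X\to\delta X$ is $e(x)=\mathcal{N}_{\mathcal{F}}(x)$. $C(\delta X)$ is the $C^{\ast}$-algebra of (bounded) continuous complex-valued functions on $\delta X$ with the supremum norm. For every $f\in\mathcal{F}$ there exists a unique $\widehat{f}\in C(\delta X)$ with $f=\widehat{f}\circ e$. *)

(* Defs.v *)
From HB Require Import structures.
From mathcomp Require Import all_boot all_order all_algebra.
From mathcomp Require Import complex.
From mathcomp Require Import all_classical all_reals all_analysis.
From mathcomp Require Import ring lra.

Set Implicit Arguments.
Unset Strict Implicit.
Unset Printing Implicit Defensive.

Import Order.TTheory GRing.Theory Num.Theory.
Import numFieldNormedType.Exports.
Import ComplexField.Normc.

Local Open Scope classical_set_scope.
Local Open Scope ring_scope.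
Local Open Scope complex_scope.

(* The library puts the norm topology only on the alias R[i]^o. *)
HB.instance Definition _ (R : realType) := NormedModule.copy R[i] R[i]^o.

(* Real-valued supremum norm; the MathComp norm `|z| of R[i] lives in R[i]. *)
Definition supnorm (R : realType) (T : Type) (f : T -> R[i]) : R :=
  sup (range (fun x => normc (f x))).

(* Norm-closed *-subalgebras of the bounded functions X -> R[i]; containing the
   constants is a separate hypothesis below. *)
Record cstar_subalgebra (R : realType) (X : choiceType)
    (F : set (X -> R[i])) : Prop := CstarSubalgebra {
  csa_bounded : forall f, F f -> bounded_fun f ;
  csa_0 : F (cst 0) ;
  csa_add : forall f g, F f -> F g -> F (f \+ g) ;
  csa_scale : forall (a : R[i]) f, F f -> F (a \*o f) ;
  csa_mul : forall f g, F f -> F g -> F (f \* g) ;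
  csa_conj : forall f, F f -> F (fun x => (f x)^*) ;
  csa_closed : forall f, bounded_fun f ->
    (forall eps : R, 0 < eps -> exists2 g, F g & supnorm (f \- g) < eps) ->
    F f }.

Definition family_of (R : realType) (X : choiceType) (F : set (X -> R[i]))
    (A : set_system X) : Prop :=
  [/\ A !=set0,
      forall S, A S -> S !=set0 &
      forall S, A S -> S <> setT ->
        exists B f, [/\ A B, F f, f @` B = [set 0] & f @` (~` S) = [set 1]]].

Definition filter_of (R : realType) (X : choiceType) (F : set (X -> R[i]))
    (p : set_system X) : Prop :=
  ProperFilter p /\ family_of F p.

Definition ultrafilter_of (R : realType) (X : choiceType)
    (F : set (X -> R[i])) (p : set_system X) : Prop :=
  filter_of F p /\ forall q, filter_of F q -> p `<=` q -> q = p.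

Definition delta (R : realType) (X : choiceType) (F : set (X -> R[i])) : Type :=
  {p : set_system X | ultrafilter_of F p}.

Definition hat (R : realType) (X : choiceType) (F : set (X -> R[i]))
  (S : set X) : set (delta F) := [set p | sval p S].
Arguments hat {R X} F S _.

Section delta_topology.
Context (R : realType) (X : choiceType) (F : set (X -> R[i])).

HB.instance Definition _ := gen_eqMixin (delta F).
HB.instance Definition _ := gen_choiceMixin (delta F).

Lemma hat_cover : \bigcup_(S in [set: set X]) hat F S = setT.
Proof.
rewrite -subTset => p _; exists setT => //.
by case: p => p [[pF ?] ?]; exact: filterT.
Qed.

Lemma hat_join (S T : set X) (p : delta F) : setT S -> setT T ->
  hat F S p -> hat F T p ->
  exists U, [/\ setT U, hat F U p & hat F U `<=` hat F S `&` hat F T].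
Proof.
move=> _ _ pS pT; exists (S `&` T); split => //.
  by case: p pS pT => p [[pF ?] ?] pS pT; exact: filterI.
move=> [q [[qF ?] ?]] /= qST.
by split; apply: filterS qST => x [].
Qed.

HB.instance Definition _ :=
  isBaseTopological.Build (delta F) hat_cover hat_join.

End delta_topology.

(* The supremum of the initial topologies, i.e. the weakest topology on X making
   every f in F continuous. *)
Definition tau (R : realType) (X : choiceType) (F : set (X -> R[i])) :
    topologicalType :=
  sup_topology (fun f : {f | F f} =>
    Topological.class (initial_topology (sval f))).

Definition tau_nbhs (R : realType) (X : choiceType) (F : set (X -> R[i]))
    (x : X) : set_system X := nbhs (x : tau F).

Section evaluation.
Context (R : realType) (X : choiceType) (F : set (X -> R[i])).
Hypotheses (FA : cstar_subalgebra F) (Fcst : forall c, F (cst c)).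

Let Freal (u : X -> R) : Prop := F (fun x => (u x)%:C).

Let Freal_cst r : Freal (cst r). Proof. exact: (Fcst r%:C). Qed.

Let FrealD u v : Freal u -> Freal v -> Freal (u \+ v).
Proof.
move=> Fu Fv; have := csa_add FA Fu Fv.
by congr F; apply/funext => x /=; rewrite rmorphD.
Qed.

Let FrealM u v : Freal u -> Freal v -> Freal (u \* v).
Proof.
move=> Fu Fv; have := csa_mul FA Fu Fv.
by congr F; apply/funext => x /=; rewrite rmorphM.
Qed.

Let FrealZ r u : Freal u -> Freal (r \*o u).
Proof. by move=> Fu; exact: (FrealM (Freal_cst r) Fu). Qed.

Let FrealB u v : Freal u -> Freal v -> Freal (u \- v).
Proof.
move=> Fu Fv; have := FrealD Fu (FrealZ (-1) Fv).
by congr Freal; apply/funext => x /=; rewrite mulN1r.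
Qed.

Let normc_real (r : R) : normc r%:C = `|r|.
Proof. by rewrite /= expr0n addr0 sqrtr_sqr. Qed.

Let normcE (z : R[i]) : `|z| = (normc z)%:C. Proof. by case: z. Qed.

Let bounded_real (u : X -> R) M :
  (forall x, `|u x| <= M) -> bounded_fun (fun x => (u x)%:C).
Proof.
move=> uM; exists M%:C; split; first by rewrite complex_real.
move=> N MN x _ /=; rewrite normcE normc_real.
by apply: le_trans (ltW MN); rewrite lecR.
Qed.

Let real_bounded (u : X -> R) : Freal u ->
  exists2 M, 0 < M & forall x, `|u x| <= M.
Proof.
move=> /(csa_bounded FA) [M [Mr uM]].
exists (`|complex.Re M| + 1) => [|x]; first by rewrite ltr_pwDr.
have /uM/(_ x I) : M < (`|complex.Re M| + 1)%:C.
  rewrite -(RRe_real Mr) ltcR.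
  by apply: le_lt_trans (ler_norm _) _; rewrite ltrDl.
by rewrite /= normcE normc_real lecR.
Qed.

Let Freal_closed (x0 : X) (u : X -> R) M : (forall x, `|u x| <= M) ->
  (forall eps : R, 0 < eps -> exists2 v, Freal v & forall x, `|u x - v x| <= eps) ->
  Freal u.
Proof.
move=> uM uF; apply: (csa_closed FA); first exact: bounded_real uM.
move=> eps e0; have e20 : 0 < eps / 2 by rewrite divr_gt0.
have [v Fv uv] := uF _ e20.
exists (fun x => (v x)%:C); first exact: Fv.
rewrite /supnorm; apply: (@le_lt_trans _ _ (eps / 2)); last by lra.
apply: ge_sup; first by exists (normc ((u x0)%:C - (v x0)%:C)); exists x0.
by move=> _ [x _ <-]; have := uv x; rewrite -normc_real rmorphB.
Qed.

(* The iteration s <- s + (t ^ 2 - s ^ 2) / 2 converges to `|t| uniformly on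
   [-1, 1], which puts the absolute value of a real function of F in F. *)
Let approx_abs (t : R) : nat -> R :=
  fix s n := if n is m.+1 then s m + (t ^+ 2 - s m ^+ 2) / 2 else 0.

Let approx_absP t n : `|t| <= 1 ->
  0 <= approx_abs t n <= `|t| /\ `|t| - approx_abs t n <= 2 / n.+2%:R.
Proof.
move=> t1; elim: n => [|n [/andP[s0 st] sn]] /=.
  by rewrite lexx normr_ge0 subr0 divff.
set s := approx_abs t n in s0 st sn *.
rewrite -[t ^+ 2]real_normK ?num_real//.
set a := `|t| in t1 st sn *.
have a0 : 0 <= a by exact: normr_ge0.
split; first by apply/andP; split; nra.
have n0 : 0 < n.+2%:R :> R by rewrite ltr0n.
have n1 : 1 <= n.+2%:R / 2 :> R.
  by rewrite ler_pdivlMr// mul1r ler_nat.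
rewrite ler_pdivlMr ?ltr0n// -[n.+3]addn1 natrD.
set m : R := n.+2%:R in n0 n1 sn *.
have {}sn : (a - s) * m <= 2 by rewrite -ler_pdivlMr.
have d1 : a - (s + (a ^+ 2 - s ^+ 2) / 2) <= (a - s) * (1 - (a - s) / 2) by nra.
have [d0 m2] : 0 <= a - s /\ 2 <= m by split; lra.
set d := a - s in sn d1 d0.
apply: (@le_trans _ _ (d * (1 - d / 2) * (m + 1))).
  by rewrite ler_wpM2r//; lra.
have d1' : d <= 1 by rewrite /d; lra.
pose c := 2 / m.
have cm : c * m = 2 by rewrite /c divfK// gt_eqF.
have c1 : c <= 1 by rewrite /c ler_pdivrMr// mul1r.
have dc : d <= c by rewrite /c ler_pdivlMr.
apply: (@le_trans _ _ (c * (1 - c / 2) * (m + 1))).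
  rewrite ler_wpM2r//; first by lra.
  have : 0 <= (c - d) * (1 - (c + d) / 2) by rewrite mulr_ge0//; lra.
  lra.
have -> : c * (1 - c / 2) * (m + 1) = (1 - c / 2) * (c * m + c) by ring.
rewrite cm; have := sqr_ge0 c; lra.
Qed.

Let Freal_approx u n : Freal u -> Freal (fun x => approx_abs (u x) n).
Proof.
move=> Fu; elim: n => [|n IHn] /=; first exact: Freal_cst.
have := FrealD IHn (FrealZ 2^-1 (FrealB (FrealM Fu Fu) (FrealM IHn IHn))).
by congr Freal; apply/funext => x /=; rewrite !expr2 [_^-1 * _]mulrC.
Qed.

Let Freal_abs (x0 : X) u : Freal u -> Freal (fun x => `|u x|).
Proof.
move=> Fu; have [M M0 uM] := real_bounded Fu.
pose v : X -> R := M^-1 \*o u.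
have Fv : Freal v by exact: FrealZ.
have v1 x : `|v x| <= 1.
  by rewrite /v /= normrM normfV (gtr0_norm M0) mulrC ler_pdivrMr// mul1r.
suff Fnv : Freal (fun x => `|v x|).
  have := FrealZ M Fnv; congr Freal; apply/funext => x.
  by rewrite /v /= normrM normfV (gtr0_norm M0) mulVKf// gt_eqF.
apply: (Freal_closed x0 (M := 1)) => [x|eps e0]; first by rewrite normr_id.
have [n ne] : exists n, 2 / eps < n.+2%:R.
  have [n _ /(_ _ (leqnn n)) ne] := nbhs_infty_gtr (2 / eps).
  by exists n; apply: lt_le_trans ne _; rewrite ler_nat -addn2 leq_addr.
exists (fun x => approx_abs (v x) n) => [|x]; first exact: Freal_approx.
have [/andP[_ sv] vs] := approx_absP n (v1 x).
rewrite ger0_norm ?subr_ge0//; apply: le_trans vs _.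
by rewrite ler_pdivrMr// mulrC -ler_pdivrMr// ltW.
Qed.

Let tau_continuous f : F f -> continuous (f : tau F -> R[i]).
Proof.
move=> Ff x; pose i : {f | F f} := exist _ f Ff.
have /cvg_sup/(_ i) : nbhs (x : tau F) --> (x : tau F) by exact: cvg_id.
by move=> xi; apply: cvg_trans (@initial_continuous _ _ f x); exact: cvg_app.
Qed.

Let tau_nbhs_preimage f x U : F f -> nbhs (f x) U -> tau_nbhs F x (f @^-1` U).
Proof. by move=> Ff; exact: tau_continuous. Qed.

(* Every neighborhood of x contains {h < 1} for some nonnegative h in F
   vanishing at x. *)
Let tau_nbhs_base x S : tau_nbhs F x S -> exists h : X -> R,
  [/\ Freal h, forall y, 0 <= h y, h x = 0 & forall y, h y < 1 -> S y].
Proof.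
pose G : set_system X := fun S => exists h : X -> R,
  [/\ Freal h, forall y, 0 <= h y, h x = 0 & forall y, h y < 1 -> S y].
suff : G --> (x : tau F) by apply.
have FG : Filter G.
  split.
  - by exists (cst 0); split => //; exact: Freal_cst.
  - move=> P Q [g [Fg g0 gx gP]] [h [Fh h0 hx hQ]].
    exists (g \+ h); split => [|y||y gh1] /=; first exact: FrealD.
    + exact: addr_ge0.
    + by rewrite gx hx addr0.
    + by split; [apply: gP|apply: hQ]; apply: le_lt_trans gh1;
        rewrite ?lerDl ?lerDr.
  - move=> P Q PQ [h [Fh h0 hx hP]]; exists h; split => // y hy.
    exact/PQ/hP.
apply/cvg_sup => -[f Ff] A /=.
rewrite (@nbhsE (initial_topology f)) => -[_ [[U oU <-] Ufx]] UA; apply: (@filterS _ G FG _ _ UA).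
have /nbhs_ballP[e e0 eU] : nbhs (f x) U by exact: open_nbhs_nbhs.
pose r := complex.Re e.
have er : e = r%:C by rewrite RRe_real// gtr0_real.
have r0 : 0 < r by move: e0; rewrite /= er ltcR.
exists (fun y => (normc (f y - f x) / r) ^+ 2); split.
- have Fd : F (fun y => f y - f x) by exact: (csa_add FA Ff (Fcst _)).
  have := csa_scale FA ((r^-1 ^+ 2)%:C) (csa_mul FA Fd (csa_conj FA Fd)).
  congr F; apply/funext => y /=.
  by rewrite -sqr_normc normcE -rmorphXn -rmorphM/= exprMn mulrC.
- by move=> y; exact: sqr_ge0.
- by rewrite subrr normc0 mul0r expr0n.
- move=> y; have n0 z : 0 <= normc z by case: z => ? ?; exact: sqrtr_ge0.
  have d0 : 0 <= normc (f y - f x) / r by rewrite divr_ge0 ?n0 ?ltW.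
  rewrite expr_lt1//.
  rewrite ltr_pdivrMr// mul1r => fyx; apply: eU.
  by rewrite -ball_normE /= distrC normcE er ltcR.
Qed.

Lemma tau_nbhs_filter_of x : filter_of F (tau_nbhs F x).
Proof.
have PF : ProperFilter (tau_nbhs F x) by exact: (@nbhs_pfilter (tau F)).
split => //; split => [|S|S NS ST]; first by exists setT; exact: filterT.
  exact: filter_ex.
have [h [Fh h0 hx hS]] := tau_nbhs_base NS.
pose m y := 2^-1 * (h y + 1 - `|h y - 1|).
pose w y := 2 * m y - 1.
pose g y := 2^-1 * (w y + `|w y|).
have Fm : Freal m.
  apply: FrealZ; apply: FrealB; first exact: (FrealD Fh (Freal_cst 1)).
  exact: (Freal_abs x (FrealB Fh (Freal_cst 1))).
have Fw : Freal w by exact: (FrealB (FrealZ 2 Fm) (Freal_cst 1)).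
have Fg : Freal g by exact: (FrealZ _ (FrealD Fw (Freal_abs x Fw))).
pose B := [set y | h y < 2^-1].
have g0 y : B y -> g y = 0.
  rewrite /B/= => hy; rewrite /g /w /m.
  by rewrite (@ltr0_norm _ (h y - 1)) ?(@ltr0_norm _ (_ * _ - 1)); lra.
have g1 y : ~ S y -> g y = 1.
  move=> Sy; have hy : 1 <= h y by rewrite leNgt; apply/negP => /hS.
  rewrite /g /w /m (@ger0_norm _ (h y - 1)) ?subr_ge0//.
  by rewrite ger0_norm; lra.
have NB : tau_nbhs F x B.
  pose k y := (h y)%:C.
  have kB : k @^-1` ball (k x) (2^-1)%:C `<=` B.
    move=> y; rewrite /B /= -ball_normE /= -rmorphB normcE normc_real ltcR hx.
    by rewrite sub0r normrN ger0_norm.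
  apply: (@filterS _ (tau_nbhs F x) _ _ _ kB).
  apply: (@tau_nbhs_preimage k) => //.
  by apply: nbhsx_ballx; rewrite ltcR invr_gt0.
exists B, (fun y => (g y)%:C); split => //.
  apply/seteqP; split => [_ [y By <-]|_ ->] /=; first by rewrite g0.
  by exists x; rewrite ?g0// /B/= hx invr_gt0.
have [y Sy] : exists y, ~ S y.
  by apply/existsNP => allS; apply: ST; apply/seteqP; split.
apply/seteqP; split => [_ [z Sz <-]|_ ->] /=; first by rewrite g1.
by exists y; rewrite ?g1.
Qed.

Lemma tau_nbhs_ultrafilter_of x : ultrafilter_of F (tau_nbhs F x).
Proof.
split; first exact: tau_nbhs_filter_of.
have [NF _] := tau_nbhs_filter_of x.
move=> q [PF [_ _ qF]] Nq; apply/seteqP; split => // S qS.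
have [->|/eqP ST] := eqVneq S setT; first exact: filterT.
have [B [f [qB Ff fB fS]]] := qF _ qS ST.
pose V e := [set y | ball (f x) e%:C (f y)].
have NV (e : R) : 0 < e -> tau_nbhs F x (V e).
  move=> e0; apply: (@tau_nbhs_preimage f x (ball (f x) e%:C)) => //.
  by apply: nbhsx_ballx; rewrite ltcR.
have fx0 : f x = 0.
  apply: eq0_normc; apply/eqP; rewrite eq_le -!lecR -!normcE normr_ge0 andbT.
  rewrite normcE lecR; apply/ler_addgt0Pl => e e0; rewrite addr0.
  have [y [Vy By]] := filter_ex (filterI (Nq _ (NV _ e0)) qB).
  have fy : f y = 0.
    by have : [set 0] (f y) by rewrite -fB; exists y.
  by move: Vy; rewrite /V/= -ball_normE/= fy subr0 normcE ltcR => /ltW.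
have := NV _ (@ltr01 R).
apply: (@filterS _ (tau_nbhs F x)) => y; rewrite /V/=.
rewrite -ball_normE/= fx0 sub0r normrN => fy1.
apply: contrapT => Sy; have fy : [set 1] (f y) by rewrite -fS; exists y.
by move: fy1; rewrite fy normr1 ltxx.
Qed.

Definition eval_delta (x : X) : delta F :=
  exist _ (tau_nbhs F x) (tau_nbhs_ultrafilter_of x).

End evaluation.

Definition Cbounded (R : realType) (T : topologicalType) : set (T -> R[i]) :=
  [set g | continuous g /\ bounded_fun g].

Definition extends (R : realType) (X : choiceType) (F : set (X -> R[i]))
    (FA : cstar_subalgebra F) (Fcst : forall c, F (cst c))
    (f : X -> R[i]) (g : delta F -> R[i]) : Prop :=
  Cbounded g /\ f = g \o eval_delta FA Fcst.

(* Gamma f is the unique g with extends f g; cst 0 is a default value that is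
   never used for f in F, by the first half of the main theorem. *)
Definition Gamma (R : realType) (X : choiceType) (F : set (X -> R[i]))
    (FA : cstar_subalgebra F) (Fcst : forall c, F (cst c))
    (f : X -> R[i]) : delta F -> R[i] :=
  xget (cst 0) [set g | extends FA Fcst f g].

Record isometric_star_isomorphism (R : realType) (S T : Type)
    (A : set (S -> R[i])) (B : set (T -> R[i]))
    (Phi : (S -> R[i]) -> (T -> R[i])) : Prop := IsometricStarIsomorphism {
  isi_bij : set_bij A B Phi ;
  isi_add : forall f g, A f -> A g -> Phi (f \+ g) = Phi f \+ Phi g ;
  isi_scale : forall (a : R[i]) f, A f -> Phi (a \*o f) = a \*o Phi f ;
  isi_mul : forall f g, A f -> A g -> Phi (f \* g) = Phi f \* Phi g ;
  isi_conj : forall f, A f -> Phi (fun x => (f x)^*) = (fun y => (Phi f y)^*) ;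
  isi_isometry : forall f, A f -> supnorm (Phi f) = supnorm f }.

(* Main.v *)
Require Import Defs.
From HB Require Import structures.
From mathcomp Require Import all_boot all_order all_algebra.
From mathcomp Require Import complex.
From mathcomp Require Import all_classical all_reals all_analysis.
From mathcomp Require Import ring lra.

Import Order.TTheory GRing.Theory Num.Theory.
Import numFieldNormedType.Exports.
Import ComplexField.Normc.

Local Open Scope classical_set_scope.
Local Open Scope ring_scope.
Local Open Scope complex_scope.

(** The real-valued members of [F] do all the work, and complex functions are
split into real and imaginary parts only at the two ends of the proof.

Order. A norm-closed subalgebra contains [|u|] with [u], because [|t|] is a
uniform limit of polynomials on [-1, 1] ([abs_iter_error], [real_part_abs]).
Hence one can truncate inside [F] ([real_part_step]): for [a < b] some element
of [F] with values in [0, 1] vanishes where [u <= a] and equals 1 where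
[b <= u].

Points of [delta F]. Every ultrafilter [U] on [X] determines an F-ultrafilter
[ultra_trace F U] contained in [U]: it consists of the sets that contain a
neighborhood of the limit of [U], as seen by [F]. Truncation is what makes it
an F-family and maximal ([ultra_trace_ultrafilter_of]). Conversely a point [p]
of [delta F] is the trace of each ultrafilter that contains it
([ultra_traceE]). As bounded functions converge along ultrafilters, it follows
that each [f] in [F] converges along each [p], and [p |-> lim f @ p] is the
continuous extension of [f].

Density. The image of the filter [p] under the evaluation converges to [p]
([eval_cvg]). So a continuous function on [delta F] is determined by its
composite with the evaluation, and so is its supremum norm. This yields
uniqueness of the extension, the algebraic identities (both sides extend the
same function) and the isometry.

Surjectivity. Let [w] be real and continuous on [delta F]. For [s < t] an
element of [F] separates [w \o e <= s] from [t <= w \o e]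
([eval_separation]); otherwise there would be an ultrafilter containing
[w \o e <= s] but no subset of [X] that can be separated from
[t <= w \o e], whereas the members of its trace include such sets. A staircase
of separating functions approximates [w \o e] uniformly ([real_part_eval]), so
[w \o e] is in [F] by closedness. *)

(** * Topology of the complex numbers through real moduli *)

Section complex_modulus.
Context {R : realType}.
Implicit Types (z : R[i]) (r : R).

Lemma normr_normc z : `|z| = (normc z)%:C. Proof. by case: z. Qed.

Lemma normc_ge0 z : 0 <= normc z.
Proof. by case: z => a b; exact: sqrtr_ge0. Qed.

Lemma normc_real r : normc r%:C = `|r|.
Proof. by rewrite /= expr0n addr0 sqrtr_sqr. Qed.

Lemma normr_Re_le z : `|complex.Re z| <= normc z.
Proof.
by case: z => a b /=; rewrite -sqrtr_sqr ler_wsqrtr// lerDl sqr_ge0.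
Qed.

Lemma normr_Im_le z : `|complex.Im z| <= normc z.
Proof.
by case: z => a b /=; rewrite -sqrtr_sqr ler_wsqrtr// lerDr sqr_ge0.
Qed.

Lemma gt0_complexE {e : R[i]} : 0 < e -> exists2 r, 0 < r & e = r%:C.
Proof.
move=> e0; have er : e = (complex.Re e)%:C by rewrite RRe_real// gtr0_real.
by exists (complex.Re e) => //; move: e0; rewrite er ltcR.
Qed.

Lemma bounded_normcP {T : Type} (f : T -> R[i]) :
  bounded_fun f <-> exists M, forall x, normc (f x) <= M.
Proof.
split=> [[M [Mr fM]]|[M fM]].
  exists (`|complex.Re M| + 1) => x.
  rewrite -lecR -normr_normc; apply: fM => //.
  rewrite -(RRe_real Mr) ltcR /=.
  by apply: le_lt_trans (ler_norm _) _; rewrite ltrDl.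
exists M%:C; split; first by rewrite complex_real.
move=> N MN x _ /=; rewrite normr_normc.
by apply: le_trans (ltW MN); rewrite lecR.
Qed.

Lemma nbhs_normcP z (A : set R[i]) :
  nbhs z A <-> exists2 r, 0 < r & forall w, normc (z - w) < r -> A w.
Proof.
split=> [/nbhs_ballP[e /= /gt0_complexE[r r0 ->] zA]|[r r0 zA]].
  by exists r => // w zw; apply: zA; rewrite -ball_normE /= normr_normc ltcR.
apply/nbhs_ballP; exists r%:C; first by rewrite /= ltcR.
by move=> w; rewrite -ball_normE /= normr_normc ltcR => /zA.
Qed.

Lemma continuous_real_complex : continuous (fun r => r%:C).
Proof.
move=> r A /nbhs_normcP[e e0 rA]; apply/nbhs_ballP; exists e => //= s.
by rewrite -ball_normE /= => rs; apply: rA; rewrite -rmorphB normc_real.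
Qed.

Lemma continuous_Re : continuous (@complex.Re R).
Proof.
move=> z A /nbhs_ballP[e e0 zA]; apply/nbhs_normcP; exists e => // w zw.
apply: zA; rewrite -ball_normE /=; apply: le_lt_trans zw.
by apply: le_trans (normr_Re_le _); case: z w => a b [].
Qed.

Lemma continuous_Im : continuous (@complex.Im R).
Proof.
move=> z A /nbhs_ballP[e e0 zA]; apply/nbhs_normcP; exists e => // w zw.
apply: zA; rewrite -ball_normE /=; apply: le_lt_trans zw.
by apply: le_trans (normr_Im_le _); case: z w => a b [].
Qed.

Lemma continuous_conjc : continuous (@conjc R).
Proof.
move=> z A /nbhs_normcP[r r0 zA]; apply/nbhs_normcP; exists r => // w zw.
apply: zA; rewrite -rmorphB; case: (z - w) zw => a b /=.
by rewrite sqrrN.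
Qed.

Lemma continuous_Complex {T : topologicalType} (u v : T -> R) :
  continuous u -> continuous v -> continuous (fun x => (u x +i* v x)%C : R[i]).
Proof.
move=> cu cv x.
have -> : (fun x => (u x +i* v x)%C) =
    (fun x => (u x)%:C) \+ (fun x => 'i%C * (v x)%:C) :> (T -> R[i]).
  by apply/funext => y /=; rewrite [LHS]complexE.
apply: continuousD.
  by apply: (continuous_comp (cu x)); exact: continuous_real_complex.
apply: continuousM; first exact: cvg_cst.
by apply: (continuous_comp (cv x)); exact: continuous_real_complex.
Qed.

Lemma supnorm_sub_le {T : Type} (f g : T -> R[i]) (x0 : T) e :
  (forall x, normc (f x - g x) <= e) -> supnorm (f \- g) <= e.
Proof.
move=> fge; apply: ge_sup; first by exists (normc (f x0 - g x0)); exists x0.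
by move=> _ [x _ <-]; exact: fge.
Qed.

End complex_modulus.

(** * Polynomial approximation of the absolute value *)

Section absolute_value_iteration.
Context {R : realType}.
Implicit Types (t : R) (n : nat).

Fixpoint abs_iter t n : R :=
  if n is m.+1 then abs_iter t m + (t ^+ 2 - abs_iter t m ^+ 2) / 2 else 0.

(** The left factor telescopes the geometric sum of the [v ^+ i], [i <= n], each
of which is at least [v ^+ n]. *)
Lemma mul_onem_expr_le (v : R) n : 0 <= v <= 1 ->
  (1 - v) * v ^+ n <= n.+1%:R^-1.
Proof.
move=> /andP[v0 v1]; rewrite -[_^-1]mul1r ler_pdivlMr ?ltr0n//.
apply: (@le_trans _ _ (1 - v ^+ n.+1)); last by rewrite gerBl exprn_ge0.
rewrite -[leRHS]opprB subrX1 -mulNr opprB -mulrA ler_wpM2l ?subr_ge0//.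
rewrite mulr_natr -[X in _ *+ X]card_ord -sumr_const; apply: ler_sum => i _.
by rewrite ler_wiXn2l// -ltnS.
Qed.

(** With [a] the absolute value of [t] and [s] an iterate, the error satisfies
[a - s' = (a - s) * (1 - (a + s) / 2)]. So it stays nonnegative and is at most
[a * (1 - a / 2) ^+ n], which [mul_onem_expr_le] bounds independently of [t]. *)
Lemma abs_iter_error t n : `|t| <= 1 ->
  0 <= `|t| - abs_iter t n <= 2 / n.+1%:R.
Proof.
set a := `|t| => a1; have a0 : 0 <= a by exact: normr_ge0.
suff [sa s0 d] : [/\ abs_iter t n <= a, 0 <= abs_iter t n &
    a - abs_iter t n <= a * (1 - a / 2) ^+ n].
  rewrite subr_ge0 sa /=; apply: le_trans d _.
  have : (1 - (1 - a / 2)) * (1 - a / 2) ^+ n <= n.+1%:R^-1.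
    by apply: mul_onem_expr_le; lra.
  rewrite (_ : 1 - (1 - a / 2) = a / 2); last by field.
  set v := (1 - a / 2) ^+ n; set w : R := n.+1%:R^-1.
  by clearbody v w; lra.
elim: n => [|n [sa s0 d]] /=; first by split; rewrite ?expr0; lra.
rewrite -[t ^+ 2]real_normK ?num_real// -/a.
move: (abs_iter t n) sa s0 d => s sa s0 d.
split; [by nra|by nra|].
rewrite [leRHS](_ : _ = a * (1 - a / 2) ^+ n * (1 - a / 2)); last first.
  by rewrite exprSr mulrA.
have -> : a - (s + (a ^+ 2 - s ^+ 2) / 2) = (a - s) * (1 - (a + s) / 2) by field.
apply: (@le_trans _ _ ((a - s) * (1 - a / 2))); last by rewrite ler_wpM2r//; lra.
by rewrite ler_wpM2l//; lra.
Qed.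

End absolute_value_iteration.

(** * Real functions in the algebra *)

(** These are also the real parts of the elements of [F], since [F] is closed
under conjugation. *)
Definition real_part {R : realType} {X : choiceType} (F : set (X -> R[i])) :
    set (X -> R) :=
  [set u | F (fun x => (u x)%:C)].

Section real_part.
Context {R : realType} {X : choiceType} {F : set (X -> R[i])}.
Hypotheses (FA : cstar_subalgebra F) (Fcst : forall c, F (cst c)).
Implicit Types (u v : X -> R) (f : X -> R[i]).

Lemma real_part_cst r : real_part F (cst r).
Proof. exact: (Fcst r%:C). Qed.

Lemma real_partD u v : real_part F u -> real_part F v -> real_part F (u \+ v).
Proof.
move=> Fu Fv; have := csa_add FA Fu Fv.
by congr F; apply/funext => x /=; rewrite rmorphD.
Qed.

Lemma real_partM u v : real_part F u -> real_part F v -> real_part F (u \* v).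
Proof.
move=> Fu Fv; have := csa_mul FA Fu Fv.
by congr F; apply/funext => x /=; rewrite rmorphM.
Qed.

Lemma real_partZ r u : real_part F u -> real_part F (fun x => r * u x).
Proof. by move=> Fu; exact: (real_partM _ _ (real_part_cst r) Fu). Qed.

Lemma real_partB u v : real_part F u -> real_part F v -> real_part F (u \- v).
Proof.
move=> Fu Fv; have := real_partD _ _ Fu (real_partZ (-1) _ Fv).
by congr (real_part F); apply/funext => x /=; rewrite mulN1r.
Qed.

(** The modulus itself would need a square root; its square is [f] times the
conjugate of [f]. *)
Lemma real_part_normc2 f : F f -> real_part F (fun x => normc (f x) ^+ 2).
Proof.
move=> Ff; have := csa_mul FA Ff (csa_conj FA Ff).
by congr F; apply/funext => x /=; rewrite -sqr_normc normr_normc -rmorphXn.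
Qed.

Lemma real_part_Re f : F f -> real_part F (fun x => complex.Re (f x)).
Proof.
move=> Ff; have := csa_scale FA (2^-1) (csa_add FA Ff (csa_conj FA Ff)).
by congr F; apply/funext => x /=; rewrite ReJ_add mulrC.
Qed.

Lemma real_part_Im f : F f -> real_part F (fun x => complex.Im (f x)).
Proof.
move=> Ff; have := real_part_Re _ (csa_scale FA (- 'i%C) Ff).
congr F; apply/funext => x /=.
by rewrite mulNr mulrC raddfN /= ReiNIm opprK.
Qed.

Lemma real_part_Complex u v : real_part F u -> real_part F v ->
  F (fun x => (u x +i* v x)%C).
Proof.
move=> Fu Fv; have := csa_add FA Fu (csa_scale FA 'i%C Fv).
by congr F; apply/funext => x /=; rewrite [RHS]complexE.
Qed.

Lemma real_part_bounded u : real_part F u ->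
  exists2 M, 0 < M & forall x, `|u x| <= M.
Proof.
move=> /(csa_bounded FA)/bounded_normcP[M uM]; exists (`|M| + 1) => [|x].
  by rewrite ltr_wpDl.
rewrite -normc_real; apply: le_trans (uM x) _.
by apply: le_trans (ler_norm M) _; rewrite lerDl.
Qed.

Section nonempty.
Hypothesis X0 : [set: X] !=set0.

Lemma real_part_closed u :
  (forall e, 0 < e -> exists2 v, real_part F v & forall x, `|u x - v x| <= e) ->
  real_part F u.
Proof.
have [x0 _] := X0 => uF; apply: (csa_closed FA).
  have [v Fv uv] := uF 1 ltr01; have [M _ vM] := real_part_bounded _ Fv.
  apply/bounded_normcP; exists (1 + M) => x; rewrite normc_real.
  by rewrite -[u x](subrK (v x)); apply: le_trans (ler_normD _ _) _; rewrite lerD.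
move=> e e0; have [v Fv uv] := uF (e / 2) (divr_gt0 e0 (ltr0n R 2)).
exists (fun x => (v x)%:C) => //; apply: (@le_lt_trans _ _ (e / 2)); last by lra.
by apply: supnorm_sub_le => // x; rewrite -rmorphB normc_real.
Qed.

(** After scaling [u] into [-1, 1], the polynomials [abs_iter] in [u] converge
uniformly to its absolute value. *)
Lemma real_part_abs u : real_part F u -> real_part F (fun x => `|u x|).
Proof.
move=> Fu; have [M M0 uM] := real_part_bounded _ Fu.
pose v x := M^-1 * u x; have Fv : real_part F v by exact: real_partZ.
have Mv x : `|u x| = M * `|v x|.
  by rewrite normrM gtr0_norm ?invr_gt0// mulVKf// gt_eqF.
have v1 x : `|v x| <= 1 by rewrite -(ler_pM2l M0) -Mv mulr1.
rewrite (_ : (fun x => _) = (fun x => M * `|v x|)); last exact/funext.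
apply: real_partZ; apply: real_part_closed => e e0.
have [n ne] : exists n, 2 / e < n.+1%:R.
  have [n _ /(_ _ (leqnn n)) ne] := nbhs_infty_gtr (2 / e).
  by exists n; apply: lt_trans ne _; rewrite ltr_nat.
exists (fun x => abs_iter (v x) n) => [|x].
  elim: n {ne} => [|n IHn] /=; first exact: real_part_cst.
  have := real_partD _ _ IHn
    (real_partZ 2^-1 _ (real_partB _ _ (real_partM _ _ Fv Fv) (real_partM _ _ IHn IHn))).
  by congr (real_part F); apply/funext => x /=; rewrite !expr2 [_^-1 * _]mulrC.
have /andP[d0 dn] := abs_iter_error _ n (v1 x).
rewrite ger0_norm//; apply: le_trans dn _.
by rewrite ler_pdivrMr ?ltr0n// mulrC -ler_pdivrMr// ltW.
Qed.

(** Truncation: being an F-family asks for functions that are exactly 0 and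
exactly 1 on given sets, whereas convergence only provides functions that are
close to these values. *)
Lemma real_part_step u (a b : R) : a < b -> real_part F u ->
  exists v, [/\ real_part F v, forall x, 0 <= v x <= 1,
    forall x, u x <= a -> v x = 0 & forall x, b <= u x -> v x = 1].
Proof.
move=> ab Fu; pose w x := (b - a)^-1 * (u x - a).
have Fw : real_part F w.
  exact: real_partZ (real_partB _ _ Fu (real_part_cst a)).
(* The clamp of w to [0, 1], where w is affine in u with values 0 at a, 1 at b. *)
exists (fun x => 2^-1 * (`|w x| - `|w x - 1| + 1)); split.
- apply: real_partZ; apply: (real_partD _ _ _ (real_part_cst 1)).
  apply: real_partB; apply: real_part_abs => //.
  exact: real_partB (real_part_cst 1).
- by move=> x; case: (ler0P (w x)); case: (ler0P (w x - 1)) => *; lra.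
- move=> x ux; have w0 : w x <= 0.
    by rewrite /w pmulr_rle0 ?invr_gt0 ?subr_gt0// subr_le0.
  by rewrite (ler0_norm w0) ler0_norm; lra.
- move=> x ux; have w1 : 1 <= w x.
    by rewrite /w mulrC ler_pdivlMr ?subr_gt0// mul1r lerD2r.
  by rewrite !ger0_norm; lra.
Qed.

End nonempty.
End real_part.

(** * F-ultrafilters as traces of ultrafilters *)

Lemma fmap_ultrafilter {T V : Type} (u : T -> V) (U : set_system T)
    {UU : UltraFilter U} : UltraFilter (u @ U).
Proof.
split=> [|G GF uUG]; first exact: fmap_proper_filter.
apply/seteqP; split => // S GS.
have [//|UnS] := in_ultra_setVsetC (u @^-1` S) UU.
have [] := @filter_not_empty _ G _; rewrite -(setICr S).
by apply: filterI => //; exact: uUG.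
Qed.

Lemma ultra_cvg_bounded {R : realType} {T : Type} (U : set_system T)
    {UU : UltraFilter U} (u : T -> R) (M : R) :
  (forall x, `|u x| <= M) -> exists l : R, u @ U --> l.
Proof.
move=> uM; have := @segment_compact R (- M) M; rewrite compact_ultra => cM.
have [|l [_ ul]] := cM (u @ U) (fmap_ultrafilter u U); last by exists l.
apply: (@filterE _ U _ (u @^-1` `[- M, M])) => x.
by rewrite /= in_itv /= -ler_norml.
Qed.

(** When [U] is the principal ultrafilter at [x], this is the neighborhood filter
of [x] for [tau F]. In general it plays the role of the neighborhood filter of
an ideal point, at which [u] takes the value [lim u @ U]. *)
Definition ultra_trace {R : realType} {X : choiceType} (F : set (X -> R[i]))
    (U : set_system X) : set_system X :=
  [set S | exists u : X -> R, [/\ real_part F u, u @ U --> (0 : R) &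
    forall x, ~ S x -> u x = 1]].

Section ultrafilters.
Context {R : realType} {X : choiceType} {F : set (X -> R[i])}.
Hypotheses (X0 : [set: X] !=set0) (FA : cstar_subalgebra F).
Hypothesis Fcst : forall c, F (cst c).
Implicit Types (p U : set_system X) (u : X -> R) (S : set X).

(** Squaring the modulus turns the separating functions of an F-family into real
ones; the case of the full set, excluded from the definition of an F-family, is
settled by the zero function. *)
Lemma filter_of_real p S : filter_of F p -> p S ->
  exists B u, [/\ p B, real_part F u, forall x, B x -> u x = 0 &
    forall x, ~ S x -> u x = 1].
Proof.
move=> [pF [_ _ psep]] pS; have [ST|/eqP ST] := eqVneq S setT.
  exists setT, (cst 0); split => //; first exact: filterT.
    exact: real_part_cst.
  by move=> x; rewrite ST => /(_ I).
have [B [f [pB Ff fB fS]]] := psep _ pS ST.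
exists B, (fun x => normc (f x) ^+ 2); split => //.
- exact: real_part_normc2.
- move=> x Bx; have -> : f x = 0 by have : [set 0] (f x) by rewrite -fB; exists x.
  by rewrite normc0 expr0n.
- move=> x Sx; have -> : f x = 1 by have : [set 1] (f x) by rewrite -fS; exists x.
  by rewrite normc1 expr1n.
Qed.

(** The members of [F] are thus continuous at the ideal point defined by [U].
Truncating the distance to [l] between [e / 2] and [e] gives a function that
vanishes [U]-almost everywhere, hence tends to 0. *)
Lemma ultra_trace_near U {UU : UltraFilter U} u (l : R) (e : R) :
  real_part F u -> u @ U --> l -> 0 < e ->
  ultra_trace F U [set x | `|u x - l| < e].
Proof.
move=> Fu ul e0; have e2 : e / 2 < e by lra.
have Fd : real_part F (fun x => `|u x - l|).
  by apply: real_part_abs => //; exact: real_partB (real_part_cst Fcst l).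
have [v [Fv _ v0 v1]] := real_part_step FA Fcst X0 _ _ _ e2 Fd.
exists v; split => // [|x /negP]; last by rewrite -leNgt => /v1.
apply: cvg_near_cst.
move/cvgrPdist_lt: ul => /(_ (e / 2) (divr_gt0 e0 (ltr0n R 2))).
by apply: filterS => x; rewrite distrC => /ltW/v0 ->.
Qed.

Lemma ultra_trace_sub U {UU : UltraFilter U} : ultra_trace F U `<=` U.
Proof.
move=> S [u [Fu u0 uS]]; move/cvgrPdist_lt: u0 => /(_ 1 ltr01).
apply: filterS => x; rewrite sub0r normrN => ux1; apply: contrapT => /uS ux.
by move: ux1; rewrite ux normr1 ltxx.
Qed.

Lemma sub_ultra_trace p U {UU : UltraFilter U} :
  filter_of F p -> p `<=` U -> p `<=` ultra_trace F U.
Proof.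
move=> pF pU S /(filter_of_real _ _ pF)[B [u [/pU UB Fu uB uS]]].
exists u; split => //; apply: cvg_near_cst.
by apply: filterS UB => x /uB ->.
Qed.

(** If [u] tends to 0 along [U] and is 1 off [S], the truncation of [|u|] between
1/2 and 1 vanishes on [|u| < 1/2], which is a member of the trace, and is still
1 off [S]. *)
Lemma ultra_trace_filter_of U {UU : UltraFilter U} :
  filter_of F (ultra_trace F U).
Proof.
have T0 : ~ ultra_trace F U set0.
  by move=> /ultra_trace_sub; exact: filter_not_empty.
have TF : Filter (ultra_trace F U).
  split.
  - exists (cst 0); split => //; [exact: real_part_cst|exact: cvg_cst|].
    by move=> x /(_ I).
  - move=> S T [u [Fu u0 uS]] [v [Fv v0 vT]].
    (* 1 - (1 - u) (1 - v) equals 1 as soon as one of u, v does. *)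
    exists (u \+ v \- (u \* v)); split.
    + by apply: (real_partB FA Fcst); [exact: real_partD|exact: real_partM].
    + have : (u \+ v \- (u \* v)) @ U --> 0 + 0 - 0 * (0 : R).
        by apply: cvgB; [exact: cvgD|exact: cvgM].
      by rewrite mulr0 addr0 subr0.
    + move=> x /not_andP[/uS ux|/vT vx] /=; rewrite ?ux ?vx; lra.
  - move=> S T ST [u [Fu u0 uS]]; exists u; split => // x Tx.
    by apply: uS => /ST.
split; first by split.
split; first by exists setT; exact: filterT.
  by move=> S TS; apply/set0P/eqP => S0; apply: T0; rewrite -S0.
move=> S [u [Fu u0 uS]] ST.
have half1 : 2^-1 < 1 :> R by lra.
have Fa : real_part F (fun x => `|u x - 0|).
  by apply: real_part_abs => //; exact: real_partB (real_part_cst Fcst 0).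
have [v [Fv _ v0 v1]] := real_part_step FA Fcst X0 _ _ _ half1 Fa.
exists [set x | `|u x - 0| < 2^-1], (fun x => (v x)%:C); split => //.
- by apply: ultra_trace_near => //; rewrite invr_gt0.
- apply/seteqP; split => [_ [x /= /ltW/v0 -> <-]//|_ ->] /=.
  have [x ux] : [set x | `|u x - 0| < 2^-1] !=set0.
    apply: (@filter_ex _ U); apply: ultra_trace_sub.
    by apply: ultra_trace_near => //; rewrite invr_gt0.
  by exists x => //; rewrite v0 // ltW.
- have u1 x : ~ S x -> v x = 1 by move=> /uS ux; rewrite v1 // ux subr0 normr1.
  apply/seteqP; split => [_ [x /= /u1 -> <-]//|_ ->] /=.
  have [x Sx] : exists x, ~ S x.
    by apply/existsNP => allS; apply: ST; apply/seteqP; split.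
  by exists x => //; rewrite u1.
Qed.

(** Let [q] be an F-filter above the trace and [u] a function that vanishes on a
member [B] of [q] and is 1 off [S]. Every set [|u - l| < e], with [l] the limit
of [u] along [U], belongs to the trace, hence to [q], and therefore meets [B].
So [l = 0] and [u] witnesses that [S] is in the trace. *)
Lemma ultra_trace_ultrafilter_of U {UU : UltraFilter U} :
  ultrafilter_of F (ultra_trace F U).
Proof.
split=> [|q qF Tq]; first exact: ultra_trace_filter_of.
apply/seteqP; split => // S /(filter_of_real _ _ qF)[B [u [qB Fu uB uS]]].
exists u; split => //.
have [M _ uM] := real_part_bounded FA _ Fu.
have [l ul] := ultra_cvg_bounded U u M uM.
suff -> : (0 : R) = l by [].
have [qpf _] := qF.
apply/eqP; rewrite eq_sym -normr_le0; apply/ler_addgt0Pl => e e0; rewrite addr0.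
have qV : q [set x | `|u x - l| < e] by apply: Tq; exact: ultra_trace_near.
have [x [Bx /= ux]] := filter_ex (filterI qB qV).
by move: ux; rewrite uB// sub0r normrN => /ltW.
Qed.

Lemma ultra_traceE p U {UU : UltraFilter U} :
  ultrafilter_of F p -> p `<=` U -> p = ultra_trace F U.
Proof.
move=> [pF pmax] pU; apply/esym/pmax; first exact: ultra_trace_filter_of.
exact: sub_ultra_trace.
Qed.

End ultrafilters.

(** * The evaluation map and continuous functions on the space of ultrafilters *)

Section evaluation.
Context {R : realType} {X : choiceType} {F : set (X -> R[i])}.
Hypotheses (X0 : [set: X] !=set0) (FA : cstar_subalgebra F).
Hypothesis Fcst : forall c, F (cst c).
Implicit Types (p : delta F) (u v : X -> R).

Local Notation e := (eval_delta FA Fcst).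

#[local] Instance delta_proper_filter p : ProperFilter (sval p).
Proof. by case: p => q [[]]. Qed.

Lemma nbhs_deltaP p (O : set (delta F)) :
  nbhs p O <-> exists2 S, sval p S & hat F S `<=` O.
Proof.
rewrite nbhsE; split=> [[V [[D _ <-] [S DS pS]] VO]|[S pS SO]].
  by exists S => // q qS; apply: VO; exists S.
exists (hat F S) => //; split => //.
by exists [set S] => //; rewrite bigcup_set1.
Qed.

Lemma real_part_continuous u : real_part F u -> continuous (u : tau F -> R).
Proof.
move=> Fu x; pose f : X -> R[i] := fun y => (u y)%:C.
have fx : (f : tau F -> R[i]) @ x --> f x.
  have /cvg_sup/(_ (exist _ f Fu)) : nbhs (x : tau F) --> (x : tau F) by [].
  move=> xf; apply: cvg_trans (@initial_continuous _ _ f x).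
  exact: cvg_app.
exact: (cvg_comp _ _ fx (continuous_Re (f x))).
Qed.

(** If [u] vanishes on a member [B] of [p] and is 1 off [S], then [|u| < 1] is a
[tau F]-open subset of [S] that contains [B]; so [S] is a neighborhood of every
point of [B]. *)
Lemma eval_cvg p : e @ sval p --> p.
Proof.
move=> O /nbhs_deltaP[S pS SO].
have [pF _] := svalP p.
have [B [u [pB Fu uB uS]]] := filter_of_real FA Fcst _ _ pF pS.
apply: filterS pB => x Bx; apply: SO; rewrite /hat /= /tau_nbhs.
have : nbhs (x : tau F) [set y | `|u x - u y| < 1].
  by have /cvgrPdist_lt := real_part_continuous _ Fu x; exact.
apply: filterS => y; rewrite /= uB// sub0r normrN => uy1.
by apply: contrapT => /uS uy; move: uy1; rewrite uy normr1 ltxx.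
Qed.

Definition limit_along u p : R := lim (u @ sval p).

(** The limit exists along an ultrafilter containing [p], and [ultra_trace_near]
brings the convergence down to the trace of that ultrafilter, which is [p]. *)
Lemma limit_alongP u p : real_part F u -> u @ sval p --> limit_along u p.
Proof.
move=> Fu; have [U [UU pU]] := @ultraFilterLemma _ (sval p) _.
have [M _ uM] := real_part_bounded FA _ Fu.
have [l ul] := ultra_cvg_bounded U u M uM.
suff pl : u @ sval p --> l by exact: cvgP pl.
rewrite (ultra_traceE X0 FA Fcst _ U (svalP p) pU).
have TF := ultra_trace_filter_of X0 FA Fcst U; have [TP _] := TF.
apply/cvgrPdist_lt => r r0.
have : ultra_trace F U [set x | `|u x - l| < r] by exact: ultra_trace_near.
by apply: filterS => x; rewrite distrC.
Qed.

Lemma limit_along_continuous u :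
  real_part F u -> continuous (limit_along u).
Proof.
move=> Fu p A /nbhs_ballP[r /= r0 rA]; apply/nbhs_deltaP.
have r2 : 0 < r / 2 by lra.
exists [set x | `|limit_along u p - u x| < r / 2].
  by have /cvgrPdist_lt := limit_alongP u p Fu; exact.
move=> q qS; apply: rA; rewrite -ball_normE /=.
have qS' : \forall x \near sval q, `|limit_along u q - u x| < r / 2.
  by have /cvgrPdist_lt := limit_alongP u q Fu; exact.
have [x [/= px qx]] := filter_ex (filterI qS qS').
rewrite (splitr r) -[X in `|X|](subrKA (u x)).
by apply: le_lt_trans (ler_normD _ _) _; rewrite ltrD// distrC.
Qed.

Lemma limit_along_eval u x : real_part F u -> limit_along u (e x) = u x.
Proof. by move=> Fu; apply: cvg_lim => //; exact: real_part_continuous. Qed.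

(** Bounds on the image of [X] extend to [delta F] by density. This one serves
the uniqueness of extensions (with [M = 0]), their boundedness and the
isometry. *)
Lemma normc_le_eval (g : delta F -> R[i]) (M : R) : continuous g ->
  (forall x, normc (g (e x)) <= M) -> forall p, normc (g p) <= M.
Proof.
move=> cg gM p; apply/ler_addgt0Pl => r r0.
have ngp : nbhs (g p) [set z | normc (g p - z) < r].
  by apply/nbhs_normcP; exists r.
have [x /= px] := @filter_ex _ (sval p) _ _ (eval_cvg p _ (cg p _ ngp)).
rewrite -[g p](subrK (g (e x))); apply: le_trans (le_normcD _ _) _.
by rewrite lerD// ltW.
Qed.

(** A compactness argument carried out with ultrafilters on [X]. Call a set small
if some element of [F] vanishes on its part where [w \o e <= s] and is 1 where
[t <= w \o e]. The sets with small complement form a filter [Q]; if it were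
proper, take an ultrafilter [U] containing it and the point [p] given by the
trace of [U]. Then [w p <= s < t], so [w \o e < t] belongs to [p], and the
F-family property of [p] supplies a small set in [p], hence in [U]; its
complement is in [U] as well. *)
Lemma eval_separation (w : delta F -> R) (s t : R) : continuous w -> s < t ->
  exists v, [/\ real_part F v, forall x, w (e x) <= s -> v x = 0 &
    forall x, t <= w (e x) -> v x = 1].
Proof.
move=> cw st.
have wcvg p : w \o e @ sval p --> w p.
  by apply: cvg_comp (eval_cvg p) _; exact: cw.
pose Q : set_system X := [set T | exists v, [/\ real_part F v,
  forall x, w (e x) <= s -> ~ T x -> v x = 0 &
  forall x, t <= w (e x) -> v x = 1]].
suff : Q set0 by move=> [v [Fv v0 v1]]; exists v; split => // x /v0; exact.
apply: contrapT => Q0.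
have QF : ProperFilter Q.
  split => //; split.
  - by exists (cst 1); split => // [|x _ /(_ I)//]; exact: real_part_cst.
  - move=> S T [u [Fu u0 u1]] [v [Fv v0 v1]]; exists (u \* v); split.
    + exact: real_partM.
    + move=> x ws /not_andP[Sx|Tx] /=; first by rewrite u0// mul0r.
      by rewrite v0// mulr0.
    + by move=> x wt /=; rewrite u1// v1// mulr1.
  - move=> S T ST [v [Fv v0 v1]]; exists v; split => // x ws Tx.
    by apply: v0 => // /ST.
have [U [UU QU]] := ultraFilterLemma QF.
have Us : U [set x | w (e x) <= s].
  by apply: QU; exists (cst 1); split => //; exact: real_part_cst.
pose p : delta F := 
  exist _ _ (@ultra_trace_ultrafilter_of _ _ _ X0 FA Fcst U UU).
have pU : sval p `<=` U by exact: ultra_trace_sub.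
have wps : w p <= s.
  rewrite leNgt; apply/negP => wps.
  have /pU Uw : sval p [set x | s < w (e x)].
    exact: cvgr_gt (wcvg p) _ wps.
  have [x [/= ws]] := filter_ex (filterI Us Uw).
  by rewrite ltNge ws.
have pt : sval p [set x | w (e x) < t].
  by apply: cvgr_lt (wcvg p) _ _; exact: le_lt_trans st.
have [pF _] := svalP p.
have [B [u [/pU UB Fu uB ut]]] := filter_of_real FA Fcst _ _ pF pt.
have UnB : U (~` B).
  apply: QU; exists u; split => // [x _ /contrapT/uB //|x wt].
  by apply: ut => /=; rewrite ltNge wt.
by have [x []] := filter_ex (filterI UB UnB).
Qed.

(** Staircase approximation with steps of height [d]. The [m]-th partial sum [v]
approximates [w \o e] cut off at height [- M + m * d], and is equal to that
height wherever [w \o e] exceeds it; this second property ensures that the next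
step, which rises only above that height, starts from the right value. *)
Lemma real_part_eval (w : delta F -> R) (M : R) :
  continuous w -> (forall p, `|w p| <= M) -> real_part F (w \o e).
Proof.
move=> cw wM; apply: (real_part_closed FA X0) => d d0.
suff /(_ _)H m : exists2 v, real_part F v & forall x,
    `|Num.min (w (e x)) (- M + m%:R * d) - v x| <= d /\
    (- M + m%:R * d <= w (e x) -> v x = - M + m%:R * d).
  have [m _ /(_ _ (leqnn m)) Mm] := nbhs_infty_gtr (2 * M / d).
  have [v Fv wv] := H m; exists v => // x; have [] := wv x.
  rewrite min_l//; have := wM (e x); rewrite ler_norml => /andP[_ wle].
  by move: Mm; rewrite ltr_pdivrMr//; lra.
elim: m => [|m [v Fv wv]].
  exists (cst (- M)) => [|x]; first exact: real_part_cst.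
  rewrite mul0r addr0; split => //; have := wM (e x).
  by rewrite ler_norml => /andP[Mw _]; rewrite min_r// subrr normr0 ltW.
pose a : R := - M + m%:R * d.
have am : - M + m.+1%:R * d = a + d by rewrite /a -natr1; ring.
have ad : a < a + d by lra.
have [u0 [Fu0 u0a u0d]] := eval_separation w a (a + d) cw ad.
have [u [Fu u01 ua ud]] := real_part_step FA Fcst X0 _ _ _ ltr01 Fu0.
exists (fun x => v x + d * u x) => [|x].
  by apply: real_partD => //; exact: real_partZ.
rewrite am; have [] := wv x; rewrite -/a => wva wvE.
have /andP[ux0 ux1] := u01 x.
have [wa|wa] := lerP (w (e x)) a.
  rewrite ua ?u0a// mulr0 addr0; split => [|wd]; last by lra.
  by move: wva; rewrite !min_l//; lra.
rewrite (wvE (ltW wa)); split => [|wd]; last by rewrite ud ?u0d// mulr1.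
by have [wd|wd] := lerP (w (e x)) (a + d); rewrite ler_norml; nra.
Qed.

End evaluation.

(** * The isomorphism *)

Section gelfand.
Context {R : realType} {X : choiceType} {F : set (X -> R[i])}.
Hypotheses (X0 : [set: X] !=set0) (FA : cstar_subalgebra F).
Hypothesis Fcst : forall c, F (cst c).
Implicit Types (f : X -> R[i]) (g h : delta F -> R[i]).

Local Notation e := (eval_delta FA Fcst).
Local Notation Gamma := (Gamma FA Fcst).

Lemma continuous_extends f g : F f -> continuous g -> f = g \o e ->
  extends FA Fcst f g.
Proof.
move=> Ff cg fg; split => //; split => //; apply/bounded_normcP.
have [M fM] := (bounded_normcP f).1 (csa_bounded FA Ff).
by exists M; apply: (normc_le_eval FA Fcst) => // x; have := fM x; rewrite fg.
Qed.

Lemma extends_exists f : F f -> exists g, extends FA Fcst f g.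
Proof.
move=> Ff; have Fre := real_part_Re FA _ Ff; have Fim := real_part_Im FA _ Ff.
exists (fun p => (limit_along (fun x => complex.Re (f x)) p +i*
  limit_along (fun x => complex.Im (f x)) p)%C).
apply: continuous_extends => //.
  by apply: continuous_Complex; exact: limit_along_continuous.
by apply/funext => x /=; rewrite !limit_along_eval//; case: (f x).
Qed.

Lemma comp_eval_inj g h : continuous g -> continuous h -> g \o e = h \o e -> g = h.
Proof.
move=> cg ch gh; apply/funext => p; apply/eqP; rewrite -subr_eq0; apply/eqP.
have cgh : continuous (g \- h) by move=> q; exact: continuousB (cg q) (ch q).
apply: eq0_normc; apply/eqP; rewrite eq_le normc_ge0 andbT.
apply: (normc_le_eval FA Fcst _ _ cgh) => x /=.
by rewrite -[g (e x)]/((g \o e) x) gh /= subrr normc0.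
Qed.

(** Identities for [Gamma] follow from this one: it suffices to exhibit a
continuous function with the right values on the image of [X]. *)
Lemma GammaE f g : F f -> continuous g -> f = g \o e -> Gamma f = g.
Proof.
move=> Ff cg fg; apply: xget_unique; first exact: continuous_extends.
by move=> h [[ch _] fh]; apply: comp_eval_inj => //; rewrite -fg.
Qed.

Lemma GammaP f : F f -> extends FA Fcst f (Gamma f).
Proof. by move=> /extends_exists; exact: xgetPex. Qed.

Lemma Gamma_continuous f : F f -> continuous (Gamma f).
Proof. by move=> /GammaP[[]]. Qed.

Lemma Gamma_eval f x : F f -> Gamma f (e x) = f x.
Proof. by move=> /GammaP[_ {2}->]. Qed.

Lemma Cbounded_eval g : Cbounded g -> F (g \o e).
Proof.
move=> [cg /bounded_normcP[M gM]].
have Fre : real_part F ((fun p => complex.Re (g p)) \o e).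
  apply: (real_part_eval X0 _ _ _ M) => [p|p].
    by apply: (continuous_comp (cg p)); exact: continuous_Re.
  exact: le_trans (normr_Re_le _) (gM p).
have Fim : real_part F ((fun p => complex.Im (g p)) \o e).
  apply: (real_part_eval X0 _ _ _ M) => [p|p].
    by apply: (continuous_comp (cg p)); exact: continuous_Im.
  exact: le_trans (normr_Im_le _) (gM p).
have := real_part_Complex FA _ _ Fre Fim.
by congr F; apply/funext => x /=; case: (g (e x)).
Qed.

Lemma supnorm_eval g : Cbounded g -> supnorm (g \o e) = supnorm g.
Proof.
move=> [cg /bounded_normcP[M gM]]; have [x0 _] := X0.
have gMub : ubound (range (fun p => normc (g p))) M by move=> _ [p _ <-].
have geub : ubound (range (fun x => normc ((g \o e) x))) M.
  by move=> _ [x _ <-]; exact: gM.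
apply/eqP; rewrite eq_le; apply/andP; split; apply: ge_sup.
- by exists (normc (g (e x0))); exists x0.
- by move=> _ [x _ <-]; apply: ub_le_sup; [exists M|exists (e x)].
- by exists (normc (g (e x0))); exists (e x0).
- move=> _ [p _ <-]; move: p; apply: (normc_le_eval FA Fcst) => // x.
  by apply: ub_le_sup; [exists M|exists x].
Qed.

End gelfand.

Theorem theorem24 (R : realType) (X : choiceType) (X0 : [set: X] !=set0)
    (F : set (X -> R[i])) (FA : cstar_subalgebra F)
    (Fcst : forall c : R[i], F (cst c)) :
  (forall f, F f -> exists! g : delta F -> R[i], extends FA Fcst f g) /\
  isometric_star_isomorphism F (@Cbounded R (delta F)) (Gamma FA Fcst).
Proof.
have cG := Gamma_continuous X0 FA Fcst.
have GE f : F f -> f = Gamma FA Fcst f \o eval_delta FA Fcst.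
  by move=> Ff; apply/funext => x /=; rewrite Gamma_eval.
split=> [f Ff|].
  exists (Gamma FA Fcst f); split; first exact: GammaP.
  by move=> g [[cg _] fg]; exact: GammaE.
split.
- split.
  + by move=> f Ff; have [] := GammaP X0 FA Fcst f Ff.
  + move=> f g /set_mem Ff /set_mem Fg fg.
    by rewrite (GE f Ff) fg -GE.
  + move=> g gB; exists (g \o eval_delta FA Fcst); first exact: Cbounded_eval.
    by case: gB => cg gb; apply: GammaE => //; exact: Cbounded_eval.
- move=> f g Ff Fg; apply: GammaE; first exact: csa_add.
    by move=> p; exact: continuousD (cG f Ff p) (cG g Fg p).
  by rewrite {1}(GE f Ff) {1}(GE g Fg).
- move=> a f Ff; apply: GammaE; first exact: csa_scale.
    by move=> p; apply: (continuous_comp (cG f Ff p)); exact: mulrl_continuous.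
  by rewrite {1}(GE f Ff).
- move=> f g Ff Fg; apply: GammaE; first exact: csa_mul.
    by move=> p; exact: continuousM (cG f Ff p) (cG g Fg p).
  by rewrite {1}(GE f Ff) {1}(GE g Fg).
- move=> f Ff; apply: GammaE; first exact: csa_conj.
    move=> p; apply: (continuous_comp (cG f Ff p)); exact: continuous_conjc.
  by rewrite {1}(GE f Ff).
- move=> f Ff; rewrite [in RHS](GE f Ff) supnorm_eval//.
  by have [] := GammaP X0 FA Fcst f Ff.
Qed.
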